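(* Consider the parallel-links routing game with homogeneous costs described in the context, and suppose that $PoA=\hat J_{sys}/J^*_{sys}>1$. Then: (1) the $N$-player bargaining problem $(\mathcal G,\hat{\mathbf J})$ is essential, i.e., there exists $\mathbf g\in\mathcal G$ with $g^i<\hat J^i$ for every $i\in\mathcal N$; (2) the Nash Bargaining Solution $\tilde{\mathbf g}$ satisfies $\tilde g^i<\hat J^i$ for every $i\in\mathcal N$, and consequently $PoS<PoA$.
   Context: Parallel-links routing game: users $\mathcal N=\{1,\dots,N\}$ share parallel links $\mathcal L=\{1,\dots,L\}$ joining a common source to a common destination; link $l$ has capacity $c_l$. User $i$ has demand $r^i>0$, $R=\sum_i r^i$, and $\sum_l c_l>R$. A routing strategy of user $i$ is $\mathbf f^i=(f^i_1,\dots,f^i_L)$ with $f^i_l\ge 0$ and $\sum_l f^i_l=r^i$; a feasible profile is $\mathbf f=(\mathbf f^1,\dots,\mathbf f^N)$ of such strategies (set $\mathbf F$), and $f_l=\sum_i f^i_l$. Homogeneous costs: $J^i(\mathbf f)=\sum_{l} f^i_l T_l(f_l)$, where each $T_l:[0,\infty)\to[0,\infty)$ is strictly increasing, convex and continuously differentiable, and $T_l(f_l)=T(c_l-f_l)$ if $f_l<c_l$, $T_l(f_l)=\infty$ if $f_l\ge c_l$, for a single function $T$ not depending on the link, with $T(c_l-f_l)$ strictly increasing in $f_l$. Nash equilibrium (NEP): a feasible $\hat{\mathbf f}$ such that for every $i$, $\hat{\mathbf f}^i$ minimizes $J^i$ over user $i$'s feasible strategies when the others play $\hat{\mathbf f}^{j}$,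 $j\neq i$; in this game the NEP exists and is unique. Write $\hat J^i=J^i(\hat{\mathbf f})$, $\hat{\mathbf J}=(\hat J^1,\dots,\hat J^N)$, $\hat J_{sys}=\sum_i\hat J^i$. Social cost: $J_{sys}(\mathbf f)=\sum_i J^i(\mathbf f)=\sum_l f_lT_l(f_l)$; $J^*_{sys}$ is its minimum over $\mathbf F$. $PoA=\hat J_{sys}/J^*_{sys}$. Bargaining: $\mathcal G$ is the set of all vectors $\sum_{m=1}^M p_m\,(J^1(\mathbf f(m)),\dots,J^N(\mathbf f(m)))$ with $M$ finite, $p_m>0$, $\sum_m p_m=1$, $\mathbf f(m)\in\mathbf F$. The Nash Bargaining Solution (NBS) with disagreement point $\hat{\mathbf J}$ is the unique $\tilde{\mathbf g}$ maximizing $\prod_{i=1}^N(\hat J^i-g^i)$ over $\mathbf g\in\mathcal G$ with $g^i\le\hat J^i$ for all $i$. The Price of Selfishness is $PoS=\big(\sum_i\tilde g^i\big)/J^*_{sys}$. *)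

(* Defs.v *)
From HB Require Import structures.
From mathcomp Require Import all_boot all_order all_algebra.
From mathcomp Require Import all_classical all_reals all_analysis.
Set Implicit Arguments. Unset Strict Implicit. Unset Printing Implicit Defensive.
Import Order.TTheory GRing.Theory Num.Theory.
Import numFieldNormedType.Exports.
Local Open Scope classical_set_scope.
Local Open Scope ring_scope.

Definition strictly_incr_on {R : realType} (A : set R) (h : R -> R) : Prop :=
  forall x y, A x -> A y -> x < y -> h x < h y.

Definition convex_on {R : realType} (A : set R) (h : R -> R) : Prop :=
  forall x y t, A x -> A y -> 0 <= t -> t <= 1 ->
    h (t * x + (1 - t) * y) <= t * h x + (1 - t) * h y.

(* continuously differentiable on A (derivative taken within A, so that it is
   one-sided at an endpoint of A, as for T_l at 0) *)
Definition C1_on {R : realType} (A : set R) (h : R -> R) : Prop :=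
  exists h' : R -> R, {within A, continuous h'} /\
    forall x, A x ->
      (fun y => (h y - h x) / (y - x)) @ within A (dnbhs x) --> h' x.

(* users 'I_N, links 'I_L; a profile f i l = f^i_l *)
Definition profile (R : realType) (N L : nat) := 'I_N -> 'I_L -> R.

Definition link_flow {R : realType} {N L : nat} (f : profile R N L) (l : 'I_L) : R :=
  \sum_(j < N) f j l.

(* link cost T_l(x) = T(c_l - x) on its finite-cost domain [0, c_l) *)
Definition Tl {R : realType} {L : nat} (c : 'I_L -> R) (T : R -> R) (l : 'I_L)
  (x : R) : R := T (c l - x).

Definition link_dom {R : realType} {L : nat} (c : 'I_L -> R) (l : 'I_L) : set R :=
  [set x | 0 <= x /\ x < c l].

Definition homogeneous_costs {R : realType} {L : nat} (c : 'I_L -> R) (T : R -> R)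
  : Prop :=
  forall l : 'I_L,
    (forall x, link_dom c l x -> 0 <= Tl c T l x) /\
    strictly_incr_on (link_dom c l) (Tl c T l) /\
    convex_on (link_dom c l) (Tl c T l) /\
    C1_on (link_dom c l) (Tl c T l).

(* feasible profile with finite costs (every link strictly below capacity) *)
Definition feasible {R : realType} {N L : nat} (c : 'I_L -> R) (r : 'I_N -> R)
  (f : profile R N L) : Prop :=
  (forall i l, 0 <= f i l) /\
  (forall i, \sum_(l < L) f i l = r i) /\
  (forall l, link_flow f l < c l).

Definition Jcost {R : realType} {N L : nat} (c : 'I_L -> R) (T : R -> R)
  (f : profile R N L) (i : 'I_N) : R :=
  \sum_(l < L) f i l * Tl c T l (link_flow f l).

Definition Jsys {R : realType} {N L : nat} (c : 'I_L -> R) (T : R -> R)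
  (f : profile R N L) : R := \sum_(i < N) Jcost c T f i.

Definition deviate {R : realType} {N L : nat} (f : profile R N L) (i : 'I_N)
  (s : 'I_L -> R) : profile R N L :=
  fun j => if j == i then s else f j.

Definition is_NE {R : realType} {N L : nat} (c : 'I_L -> R) (r : 'I_N -> R)
  (T : R -> R) (f : profile R N L) : Prop :=
  feasible c r f /\
  forall i (s : 'I_L -> R), feasible c r (deviate f i s) ->
    Jcost c T f i <= Jcost c T (deviate f i s) i.

Definition is_min_social {R : realType} {N L : nat} (c : 'I_L -> R) (r : 'I_N -> R)
  (T : R -> R) (Jstar : R) : Prop :=
  (exists f : profile R N L, feasible c r f /\ Jsys c T f = Jstar) /\
  (forall f : profile R N L, feasible c r f -> Jstar <= Jsys c T f).

Definition inG {R : realType} {N L : nat} (c : 'I_L -> R) (r : 'I_N -> R)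
  (T : R -> R) (g : 'I_N -> R) : Prop :=
  exists (M : nat) (p : 'I_M -> R) (fs : 'I_M -> profile R N L),
    (forall m, 0 < p m) /\ \sum_(m < M) p m = 1 /\
    (forall m, feasible c r (fs m)) /\
    forall i, g i = \sum_(m < M) p m * Jcost c T (fs m) i.

Definition is_NBS {R : realType} {N L : nat} (c : 'I_L -> R) (r : 'I_N -> R)
  (T : R -> R) (d g : 'I_N -> R) : Prop :=
  inG (L := L) c r T g /\ (forall i, g i <= d i) /\
  forall g' : 'I_N -> R, inG (L := L) c r T g' -> (forall i, g' i <= d i) ->
    \prod_(i < N) (d i - g' i) <= \prod_(i < N) (d i - g i).

(* Main.v *)
Require Import Defs.
From HB Require Import structures.
From mathcomp Require Import all_boot all_order all_algebra.
From mathcomp Require Import all_classical all_reals all_analysis.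
From mathcomp Require Import ring lra.
Import Order.TTheory GRing.Theory Num.Theory.
Import numFieldNormedType.Exports.
Local Open Scope classical_set_scope.
Local Open Scope ring_scope.

(** At the equilibrium f, write D_l for the derivative of T_l at f_l. Moving flow
    e_j of every user j from link a to link b changes the cost of user i at rate
      e_i (T_b - T_a) - w_i (\sum_j e_j),   w_i = f^i_a D_a - f^i_b D_b.
    Let a be a cheapest link: every user uses it. The Nash conditions say that
    w_i <= T_b - T_a, with equality when i uses b, so that every w_i is positive
    as soon as T_b > T_a. Taking e = w makes the rate
      w_i (T_b - T_a - \sum_j w_j) = w_i (m_b - m_a),
    where m_l = T_l + f_l D_l is the social marginal cost: all users gain at once
    if m_b < m_a. Such a link b exists, for otherwise every used link has
    m_b = m_a, every other link has m_b >= m_a, and f is socially optimal by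
    convexity. *)

(** * Right derivatives along rays, and convexity *)

Definition quotient_limit {R : realType} (A : set R) (h : R -> R) (x D : R) : Prop :=
  (fun y => (h y - h x) / (y - x)) @ within A (dnbhs x) --> D.

Lemma near_ltr_addMr {R : realType} (x q b : R) : x < b ->
  \forall t \near 0^'+, x + t * q < b.
Proof.
move=> xb; have : (fun t : R => x + t * q) @ 0^'+ --> x + 0 * q.
  apply: cvgD; first exact: cvg_cst.
  by apply: cvgMr_tmp; apply: cvg_at_right_filter; exact: cvg_id.
rewrite mul0r addr0 => /cvgr_lt; exact.
Qed.

Lemma cvg_right_quotient {R : realType} (A : set R) (h : R -> R) (x D q : R) :
  quotient_limit A h x D -> (\forall t \near 0^'+, A (x + t * q)) ->
  (fun t => (h (x + t * q) - h x) / t) @ 0^'+ --> q * D.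
Proof.
(* For [q = 0] the ray stays at [x], which the punctured neighbourhood in [hD] excludes; this case
   is settled apart. *)
move=> hD nA; have [->|q0] := eqVneq q 0.
  rewrite mul0r; under eq_fun do rewrite mulr0 addr0 subrr mul0r.
  exact: cvg_cst.
have cA : (fun t => x + t * q) @ 0^'+ --> within A (dnbhs x).
  move=> P; rewrite /within /dnbhs /= /within /= => nP.
  have cx : (fun t : R => x + t * q) @ 0^'+ --> x.
    rewrite -[X in _ --> X]addr0 -[X in x + X](mul0r q).
    apply: cvgD; first exact: cvg_cst.
    by apply: cvgMr_tmp; apply: cvg_at_right_filter; exact: cvg_id.
  have := cx _ nP; rewrite /= /nbhs /= => nP'.
  near=> t; have At : A (x + t * q) by near: t.
  have t0 : 0 < t by near: t; exact: nbhs_right_gt.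
  have : x + t * q != x -> A (x + t * q) -> P (x + t * q) by near: t.
  by apply => //; rewrite -subr_eq0 addrAC subrr add0r mulf_neq0 // gt_eqF.
have := cvg_comp _ _ cA hD => /(cvgMl_tmp (a := q)) /=.
apply: cvg_trans; apply: near_eq_cvg; near=> t.
have t0 : 0 < t by near: t; exact: nbhs_right_gt.
rewrite /=; have -> : x + t * q - x = t * q by ring.
by field; rewrite q0 gt_eqF.
Unshelve. all: by end_near. Qed.

(** Product rule: the increment splits as [t * p * h (x + t * q)] plus [u] times the increment of
    [h]. The continuity of [h] along the ray comes from its difference quotient. *)
Lemma cvg_right_quotientM {R : realType} (A : set R) (h : R -> R)
    (x D u p q : R) :
  quotient_limit A h x D -> (\forall t \near 0^'+, A (x + t * q)) ->
  (fun t => ((u + t * p) * h (x + t * q) - u * h x) / t) @ 0^'+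
    --> p * h x + u * (q * D).
Proof.
move=> hD nA; have cq := cvg_right_quotient _ _ _ _ _ hD nA.
have ch : (fun t => h x + t * ((h (x + t * q) - h x) / t)) @ 0^'+ --> h x.
  rewrite -[X in _ --> X]addr0 -[X in _ + X](mul0r (q * D)).
  apply: cvgD; first exact: cvg_cst.
  by apply: cvgM => //; apply: cvg_at_right_filter; exact: cvg_id.
apply: cvg_trans (cvgD (cvgMl_tmp (a := p) ch) (cvgMl_tmp (a := u) cq));
  apply: near_eq_cvg; near=> t.
have t0 : 0 < t by near: t; exact: nbhs_right_gt.
by rewrite addrfctE; field; rewrite gt_eqF.
Unshelve. all: by end_near. Qed.

(** Convexity bounds each difference quotient of [h] from [x] towards [y] by [h y - h x]; let [t]
    tend to 0. *)
Lemma convex_tangent_le {R : realType} (A : set R) (h : R -> R) (x y D : R) :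
  convex_on A h -> quotient_limit A h x D ->
  (forall t, 0 <= t -> t <= 1 -> A (x + t * (y - x))) ->
  h x + D * (y - x) <= h y.
Proof.
move=> hconv hD hA.
have Ax : A x by have := hA 0 (lexx _) ler01; rewrite mul0r addr0.
have Ay : A y by have := hA 1 ler01 (lexx _); rewrite mul1r addrC subrK.
have nA : \forall t \near 0^'+, A (x + t * (y - x)).
  near=> t; apply: hA; first exact: ltW.
  by near: t; apply: nbhs_right_le.
have c := cvg_right_quotient _ _ _ _ _ hD nA.
rewrite -lerBrDl mulrC -(cvg_lim _ c)//.
apply: limr_le; first by apply/cvg_ex; eexists; exact: c.
near=> t.
have t0 : 0 < t by near: t; exact: nbhs_right_gt.
have t1 : t <= 1 by near: t; exact: nbhs_right_le.
rewrite ler_pdivrMr //.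
have := hconv y x t Ay Ax (ltW t0) t1.
have -> : t * y + (1 - t) * x = x + t * (y - x) by ring.
by lra.
Unshelve. all: by end_near. Qed.

Lemma exists_gt0_of_sum_gt0 {R : realType} (n : nat) (F : 'I_n -> R) :
  0 < \sum_(i < n) F i -> exists i, 0 < F i.
Proof.
move=> s0; apply/existsP; rewrite -[[exists _, _]]negbK negb_exists.
apply/negP => /forallP h; move: s0; rewrite ltNge sumr_le0 // => i _.
by rewrite leNgt; exact: h.
Qed.

(** * Perturbing a feasible profile along a ray *)

Section Game.
Variables (R : realType) (N L : nat) (c : 'I_L -> R) (r : 'I_N -> R) (T : R -> R).
Implicit Types (f d : profile R N L) (D : 'I_L -> R).

Definition ray f d (t : R) : profile R N L := fun i l => f i l + t * d i l.

Lemma link_flow_ray f d t l :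
  link_flow (ray f d t) l = link_flow f l + t * link_flow d l.
Proof. by rewrite /link_flow big_split /= -mulr_sumr. Qed.

(** The constraints are finite in number. Only coordinates with room decrease, and the capacity
    bounds are strict, so each survives a small step. *)
Lemma near_feasible_ray f d : feasible c r f ->
  (forall i, \sum_(l < L) d i l = 0) ->
  (forall i l, d i l < 0 -> 0 < f i l) ->
  \forall t \near 0^'+, feasible c r (ray f d t).
Proof.
move=> [f0 [fr fc]] d0 dneg.
have n1 : \forall t \near 0^'+, forall i l, 0 <= ray f d t i l.
  apply: filter_forall => i; apply: filter_forall => l.
  have [dil|dil] := ltP (d i l) 0.
    near=> t; rewrite -oppr_le0 /ray opprD -mulrN; apply: ltW; near: t.
    by apply: near_ltr_addMr; rewrite oppr_lt0 dneg.
  by near=> t; apply: addr_ge0 => //; apply: mulr_ge0.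
have n2 : \forall t \near 0^'+, forall l, link_flow (ray f d t) l < c l.
  apply: filter_forall => l; near=> t; rewrite link_flow_ray; near: t.
  exact: near_ltr_addMr.
near=> t; split; first by near: t.
split; last by near: t.
by move=> i; rewrite big_split /= -mulr_sumr d0 mulr0 addr0.
Unshelve. all: by end_near. Qed.

Lemma feasible_link_dom f l : feasible c r f -> link_dom c l (link_flow f l).
Proof. by move=> [f0 [_ fc]]; split; [apply: sumr_ge0 => i _|]. Qed.

(** Since [link_dom] starts at 0, [D l] is a right derivative on a link without flow. *)
Definition marginals f D : Prop :=
  forall l, quotient_limit (link_dom c l) (Tl c T l) (link_flow f l) (D l).

Lemma Jcost_ray_cvg f d D i : marginals f D ->
  (\forall t \near 0^'+, feasible c r (ray f d t)) ->
  (fun t => (Jcost c T (ray f d t) i - Jcost c T f i) / t) @ 0^'+ -->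
  \sum_(l < L) (d i l * Tl c T l (link_flow f l) +
                f i l * (link_flow d l * D l)).
Proof.
move=> hD nf.
have -> : (fun t => (Jcost c T (ray f d t) i - Jcost c T f i) / t) =
  (fun t => \sum_(l < L)
     ((f i l + t * d i l) * Tl c T l (link_flow f l + t * link_flow d l)
      - f i l * Tl c T l (link_flow f l)) / t).
  apply/funext => t; rewrite -mulr_suml sumrB; congr ((_ - _) / _).
  by apply: eq_bigr => l _; rewrite link_flow_ray.
apply: cvg_big => [|l _]; first exact: add_continuous.
 apply: cvg_right_quotientM; first exact: hD.
near=> t; rewrite -link_flow_ray; apply: feasible_link_dom; near: t.
exact: nf.
Unshelve. all: by end_near. Qed.

(** * Moving flow from one link to another *)

Definition shift (e : 'I_N -> R) (a b : 'I_L) : profile R N L :=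
  fun i l => e i * ((l == b)%:R - (l == a)%:R).

Lemma sum_delta_diff (a b : 'I_L) (F : 'I_L -> R) :
  \sum_(l < L) ((l == b)%:R - (l == a)%:R) * F l = F b - F a.
Proof.
under eq_bigr do rewrite mulrBl.
rewrite sumrB (bigD1 b) //= eqxx mul1r big1 => [|l /negbTE->]; last by rewrite mul0r.
rewrite (bigD1 a) //= eqxx mul1r big1 => [|l /negbTE->]; last by rewrite mul0r.
by rewrite !addr0.
Qed.

Lemma near_feasible_shift f e a b : feasible c r f ->
  (forall i, 0 <= e i) -> (forall i, 0 < e i -> 0 < f i a) ->
  \forall t \near 0^'+, feasible c r (ray f (shift e a b) t).
Proof.
move=> ff e0 ea; apply: near_feasible_ray => // [i|i l].
  rewrite -mulr_sumr; have := sum_delta_diff a b (fun=> 1).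
  by under eq_bigr do rewrite mulr1; move=> ->; rewrite subrr mulr0.
rewrite /shift; case: (eqVneq l a) => [->|_]; last first.
  by rewrite subr0 ltNge mulr_ge0.
case: (eqVneq a b) => _; first by rewrite subrr mulr0 ltxx.
by rewrite sub0r mulrN1 oppr_lt0; exact: ea.
Qed.

Lemma Jcost_shift_cvg f e a b D i : feasible c r f -> marginals f D ->
  (forall i, 0 <= e i) -> (forall i, 0 < e i -> 0 < f i a) ->
  (fun t => (Jcost c T (ray f (shift e a b) t) i - Jcost c T f i) / t) @ 0^'+ -->
  e i * (Tl c T b (link_flow f b) - Tl c T a (link_flow f a)) -
  (f i a * D a - f i b * D b) * \sum_(j < N) e j.
Proof.
move=> ff hD e0 ea.
have := Jcost_ray_cvg f _ D i hD (near_feasible_shift f e a b ff e0 ea).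
set s := (X in _ --> X -> _); set s' := (X in _ -> _ --> X).
suff -> : s = s' by [].
rewrite /s /s' big_split /=; congr (_ + _).
  by under eq_bigr do rewrite -mulrA; rewrite -mulr_sumr sum_delta_diff.
rewrite -mulNr opprB -(sum_delta_diff a b (fun l => f i l * D l)) mulr_suml.
apply: eq_bigr => l _; rewrite /link_flow /shift -mulr_suml; ring.
Qed.

(** First-order Nash condition: let user [i] alone move flow from [a] to [b]. This is a unilateral
    deviation, so the right derivative of the cost of [i] is nonnegative. *)
Lemma NE_pairwise_marginal f D i a b : is_NE c r T f -> marginals f D ->
  0 < f i a ->
  Tl c T a (link_flow f a) + f i a * D a <=
  Tl c T b (link_flow f b) + f i b * D b.
Proof.
move=> [ff hNE] hD fa; pose e j : R := (j == i)%:R.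
have e0 j : 0 <= e j by rewrite ler0n.
have ea j : 0 < e j -> 0 < f j a.
  by rewrite /e; case: (eqVneq j i) => [->|]; rewrite ?ltxx.
have nf := near_feasible_shift f e a b ff e0 ea.
have cv := Jcost_shift_cvg f e a b D i ff hD e0 ea.
have se : \sum_(j < N) e j = 1.
  by rewrite (bigD1 i) //= /e eqxx big1 ?addr0 // => j /negbTE->.
move: cv; rewrite se mulr1 /e eqxx mul1r => cv.
suff : 0 <= Tl c T b (link_flow f b) - Tl c T a (link_flow f a) -
       (f i a * D a - f i b * D b) by lra.
rewrite -(cvg_lim _ cv)//.
apply: limr_ge; first by apply/cvg_ex; eexists; exact: cv.
near=> t.
have t0 : 0 < t by near: t; exact: nbhs_right_gt.
have ft : feasible c r (ray f (shift e a b) t) by near: t; exact: nf.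
have E : ray f (shift e a b) t = deviate f i (ray f (shift e a b) t i).
  apply/funext => j; rewrite /deviate; case: (eqVneq j i) => [->//|ji].
  by apply/funext => l; rewrite /ray /shift /e (negbTE ji) mul0r mulr0 addr0.
apply: divr_ge0; last exact: ltW.
by rewrite subr_ge0; move: ft; rewrite -/e E; exact: hNE.
Unshelve. all: by end_near. Qed.

Lemma Jsys_link_flow f :
  Jsys c T f = \sum_(l < L) link_flow f l * Tl c T l (link_flow f l).
Proof.
rewrite /Jsys /Jcost exchange_big /=; apply: eq_bigr => l _.
by rewrite -mulr_suml.
Qed.

(** * Consequences of monotone convex link costs *)

Section Costs.
Hypothesis hT : homogeneous_costs c T.

Lemma exists_marginals f : feasible c r f -> exists D, marginals f D.
Proof.
move=> ff.
have /choice[D hD] : forall l, exists y,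
    quotient_limit (link_dom c l) (Tl c T l) (link_flow f l) y.
  move=> l; have [_ [_ [_ [h' [_ hh']]]]] := hT l.
  by exists (h' (link_flow f l)); apply: hh'; apply: feasible_link_dom.
by exists D.
Qed.

Lemma Jsys_ge0 f : feasible c r f -> 0 <= Jsys c T f.
Proof.
move=> ff; rewrite Jsys_link_flow; apply: sumr_ge0 => l _.
have [Tge0 _] := hT l; have fl := feasible_link_dom f l ff.
by apply: mulr_ge0; [case: fl | exact: Tge0].
Qed.

Lemma marginal_tangent f D l y : feasible c r f -> marginals f D ->
  link_dom c l y ->
  Tl c T l (link_flow f l) + D l * (y - link_flow f l) <= Tl c T l y.
Proof.
move=> ff hD [y0 yc]; have [_ [_ [hconv _]]] := hT l.
apply: convex_tangent_le (hconv) (hD l) _ => t t0 t1.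
have [x0 xc] := feasible_link_dom f l ff.
split.
  have -> : link_flow f l + t * (y - link_flow f l) =
    t * y + (1 - t) * link_flow f l by ring.
  by rewrite addr_ge0 // mulr_ge0 // subr_ge0.
have [xy|/ltW yx] := lerP (link_flow f l) y.
  by apply: le_lt_trans yc; rewrite -lerBrDl ler_piMl // subr_ge0.
by apply: le_lt_trans xc; rewrite gerDl mulr_ge0_le0 // subr_le0.
Qed.

(** The tangent at the current flow, evaluated at 0, lies below the cost at 0, which is strictly
    less than the current cost. *)
Lemma marginal_gt0 f D l : feasible c r f -> marginals f D ->
  0 < link_flow f l -> 0 < D l.
Proof.
move=> ff hD f0; have [_ [hinc _]] := hT l.
have xd := feasible_link_dom f l ff.
have zd : link_dom c l 0 by split => //; case: xd => _; exact: lt_trans.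
have := marginal_tangent f D l 0 ff hD zd.
have := hinc _ _ zd xd f0 => h1 h2.
rewrite -(pmulr_lgt0 _ f0); lra.
Qed.

Lemma marginal_ge0 f D l : feasible c r f -> marginals f D -> 0 <= D l.
Proof.
move=> ff hD; have [_ [hinc _]] := hT l.
have [x0 xc] := feasible_link_dom f l ff.
have := x0; rewrite le_eqVlt => /orP[/eqP xe|]; last first.
  by move=> /(marginal_gt0 f D l ff hD)/ltW.
(* At zero flow no point lies to the left, so the sign is read off the right difference
   quotients. *)
have nA : \forall t \near 0^'+, link_dom c l (link_flow f l + t * 1).
  near=> t; split; last by near: t; exact: near_ltr_addMr.
  by rewrite mulr1 addr_ge0.
have := cvg_right_quotient _ _ _ _ _ (hD l) nA; rewrite mul1r => cv.
rewrite -(cvg_lim _ cv)//.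
apply: limr_ge; first by apply/cvg_ex; eexists; exact: cv.
near=> t.
have t0 : 0 < t by near: t; exact: nbhs_right_gt.
have At : link_dom c l (link_flow f l + t * 1) by near: t; exact: nA.
apply: divr_ge0; last exact: ltW.
by rewrite subr_ge0; apply/ltW/hinc => //; rewrite mulr1 ltrDl.
Unshelve. all: by end_near. Qed.

(** Let a link carry flow [x] in [f] and [y] in [f']. Multiplying the tangent inequality of its cost
    by [y] leaves a surplus [D l * (y - x) ^ 2], which is nonnegative. *)
Lemma Jsys_tangent f D f' : feasible c r f -> marginals f D ->
  feasible c r f' ->
  \sum_(l < L) (Tl c T l (link_flow f l) + link_flow f l * D l) *
               (link_flow f' l - link_flow f l)
  <= Jsys c T f' - Jsys c T f.
Proof.
move=> ff hD ff'; rewrite !Jsys_link_flow -sumrB; apply: ler_sum => l _.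
have yd := feasible_link_dom f' l ff'.
have tan := marginal_tangent f D l _ ff hD yd.
have D0 := marginal_ge0 f D l ff hD; case: yd => y0 _.
have := ler_wpM2l y0 tan.
have := mulr_ge0 D0 (sqr_ge0 (link_flow f' l - link_flow f l)).
by rewrite expr2; lra.
Qed.

(** * Link use at equilibrium and the common improvement *)

Lemma sum_link_flow f : feasible c r f ->
  \sum_(l < L) link_flow f l = \sum_(i < N) r i.
Proof. by move=> [_ [fr _]]; rewrite exchange_big; apply: eq_bigr. Qed.

Lemma link_flow_gt0 f i l : feasible c r f -> 0 < f i l -> 0 < link_flow f l.
Proof.
move=> [f0 _] fil; rewrite /link_flow (bigD1 i) //=.
by apply: ltr_pwDl => //; exact: sumr_ge0.
Qed.

(** A user absent from [a] uses some link [l], where its marginal cost strictly exceeds the link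
    cost of [l], hence that of [a]: moving to [a] would pay. *)
Lemma NE_uses_cheapest_link f i a : (forall i, 0 < r i) -> is_NE c r T f ->
  (forall l, Tl c T a (link_flow f a) <= Tl c T l (link_flow f l)) ->
  0 < f i a.
Proof.
move=> hr hNE amin; have [ff _] := hNE; have [f0 [fr _]] := ff.
have [D hD] := exists_marginals f ff.
have [l fil] : exists l, 0 < f i l by apply: exists_gt0_of_sum_gt0; rewrite fr.
have := f0 i a; rewrite le_eqVlt => /orP[/eqP fia|//].
have := NE_pairwise_marginal f D i l a hNE hD fil.
have Dl := marginal_gt0 f D l ff hD (link_flow_gt0 f i l ff fil).
have := mulr_gt0 fil Dl; have := amin l; rewrite -fia; lra.
Qed.

Lemma NE_common_improvement f f' : (forall i, 0 < r i) -> is_NE c r T f ->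
  feasible c r f' -> Jsys c T f' < Jsys c T f ->
  exists g, feasible c r g /\ forall i, Jcost c T g i < Jcost c T f i.
Proof.
move=> hr hNE ff' Jlt; have [ff _] := hNE; have [f0 _] := ff.
have [D hD] := exists_marginals f ff.
pose TT l := Tl c T l (link_flow f l).
(* The positive social cost of [f] provides a link, needed to form the minimum over links. *)
have [l0 _] : exists l0 : 'I_L, 0 < TT l0 * link_flow f l0.
  apply: exists_gt0_of_sum_gt0; apply: le_lt_trans (Jsys_ge0 _ ff') _.
  rewrite (lt_le_trans Jlt) // Jsys_link_flow.
  by apply: ler_sum => l _; rewrite mulrC.
pose a := [arg min_(l < l0) TT l]%O.
have amin l : TT a <= TT l.
  by rewrite /a; case: arg_minP => //= k _; apply.
have fa i : 0 < f i a by exact: NE_uses_cheapest_link amin.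
pose m l := TT l + link_flow f l * D l.
(* Total flow is the same in [f] and [f'], so [m a] can be subtracted from every slope in the
   tangent inequality; some term of the resulting positive sum is positive. *)
have [b hb] : exists b, 0 < (m b - m a) * (link_flow f b - link_flow f' b).
  apply: exists_gt0_of_sum_gt0.
  have := Jsys_tangent f D f' ff hD ff'.
  rewrite -/TT -subr_lt0 in Jlt * => /le_lt_trans/(_ Jlt).
  rewrite -oppr_gt0 -sumrN => h.
  apply: lt_le_trans h _; rewrite -subr_ge0 -sumrB.
  rewrite [leRHS](_ : _ = - m a * \sum_(l < L) (link_flow f l - link_flow f' l)).
    by rewrite sumrB !sum_link_flow // subrr mulr0.
  by rewrite mulr_sumr; apply: eq_bigr => l _; rewrite /m /TT; ring.
pose w i := f i a * D a - f i b * D b.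
have mw : m a - m b = \sum_(i < N) w i - (TT b - TT a).
  by rewrite sumrB -!mulr_suml -!/(link_flow _ _) /m; ring.
have wb i : 0 < f i b -> w i = TT b - TT a.
  move=> fb; have := NE_pairwise_marginal f D i b a hNE hD fb.
  have := NE_pairwise_marginal f D i a b hNE hD (fa i).
  by rewrite -!/(TT _) /w; lra.
(* Otherwise [b] is a cheapest link too, all users use it, every [w i] vanishes and [m b = m a],
   against [hb]. *)
have DT : 0 < TT b - TT a.
  rewrite subr_gt0 lt_neqAle amin andbT; apply/negP => /eqP ab.
  have fb i : 0 < f i b.
    by apply: NE_uses_cheapest_link => // l; rewrite -/(TT b) -ab; exact: amin.
  move: hb; have -> : m b - m a = 0; last by rewrite mul0r ltxx.
  rewrite -opprB mw big1 ?ab ?subrr ?oppr0 // => i _.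
  by rewrite wb // ab subrr.
have w0 i : 0 < w i.
  have := f0 i b; rewrite le_eqVlt => /orP[/eqP fb|/wb->//].
  rewrite /w -fb mul0r subr0 mulr_gt0 //.
  exact: marginal_gt0 ff hD (link_flow_gt0 f i a ff (fa i)).
(* If [m a <= m b], then [hb] forces flow on [b]. A user of [b] has [w i = TT b - TT a], so the sum
   of [w] is at least that and [m b <= m a]; equality contradicts [hb]. *)
have mba : m b < m a.
  rewrite ltNge; apply/negP => mab.
  have fb : 0 < link_flow f b.
    have [f'0 _] := feasible_link_dom f' b ff'.
    rewrite ltNge; apply/negP => fb; move: hb; rewrite ltNge => /negP; apply.
    by apply: mulr_ge0_le0; rewrite ?subr_ge0 ?subr_le0 ?(le_trans fb).
  have [i fib] := exists_gt0_of_sum_gt0 _ _ fb.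
  have wi : TT b - TT a <= \sum_(j < N) w j.
    by rewrite (bigD1 i) //= wb // lerDl; apply: sumr_ge0 => j _; exact: ltW.
  have E : m b - m a = 0 by lra.
  by move: hb; rewrite E mul0r ltxx.
have nf := near_feasible_shift f w a b ff (fun i => ltW (w0 i)) (fun i _ => fa i).
have nJ : \forall t \near 0^'+, forall i,
    Jcost c T (ray f (shift w a b) t) i < Jcost c T f i.
  apply: filter_forall => i.
  have cv := Jcost_shift_cvg f w a b D i ff hD (fun i => ltW (w0 i)) (fun i _ => fa i).
  (* By [mw] this rate equals [w i * (m b - m a)]. *)
  have neg : w i * (TT b - TT a) - w i * \sum_(j < N) w j < 0.
    by rewrite -mulrBr pmulr_rlt0 //; lra.
  near=> t.
  have tV : 0 < t^-1 by rewrite invr_gt0; near: t; exact: nbhs_right_gt.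
  by rewrite -subr_lt0 -(pmulr_llt0 _ tV); near: t; exact: (cvgr_lt _ cv _ neg).
have nfJ : \forall t \near 0^'+, feasible c r (ray f (shift w a b) t) /\
    forall i, Jcost c T (ray f (shift w a b) t) i < Jcost c T f i.
  by near=> t; split; near: t.
have [t [ft Jt]] := @filter_ex _ _ (at_right_proper_filter _) _ nfJ.
by exists (ray f (shift w a b) t).
Unshelve. all: by end_near. Qed.
End Costs.
End Game.

(** * The bargaining solution and the prices *)

Lemma NBS_lt {R : realType} {N L : nat} (c : 'I_L -> R) (r : 'I_N -> R)
    (T : R -> R) (d g gt : 'I_N -> R) :
  inG (L := L) c r T g -> (forall i, g i < d i) ->
  is_NBS (L := L) c r T d gt -> forall i, gt i < d i.
Proof.
move=> gG gd [_ [gtd gtmax]] i; rewrite lt_neqAle gtd andbT.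
(* A user left at its disagreement cost makes the Nash product 0, whereas [g] gives a positive
   product. *)
apply/negP => /eqP E.
have := gtmax g gG (fun i => ltW (gd i)).
rewrite [leRHS](bigD1 i) //= E subrr mul0r leNgt => /negP; apply.
by apply: prodr_gt0 => j _; rewrite subr_gt0.
Qed.

Theorem theorem3p1 (R : realType) (N L : nat) (c : 'I_L -> R) (r : 'I_N -> R)
  (T : R -> R)
  (hc : forall l, 0 < c l) (hr : forall i, 0 < r i)
  (hcap : \sum_(i < N) r i < \sum_(l < L) c l)
  (hT : homogeneous_costs c T)
  (fh : profile R N L) (hNE : is_NE c r T fh)
  (Jstar : R) (hopt : is_min_social (N := N) c r T Jstar)
  (hPoA : 1 < Jsys c T fh / Jstar) :
  (exists g : 'I_N -> R, inG (L := L) c r T g /\ forall i, g i < Jcost c T fh i) /\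
  (forall gt : 'I_N -> R, is_NBS (L := L) c r T (Jcost c T fh) gt ->
     (forall i, gt i < Jcost c T fh i) /\
     (\sum_(i < N) gt i) / Jstar < Jsys c T fh / Jstar).
Proof.
have [[f' [ff' Jf']] _] := hopt.
have Jstar_gt0 : 0 < Jstar.
  rewrite lt_def -{2}Jf' (Jsys_ge0 _ _ _ _ _ _ hT _ ff') andbT.
  (* Division by 0 yields 0, so [Jstar = 0] would make the ratio 0, against [hPoA]. *)
  by apply: contraTneq hPoA => ->; rewrite invr0 mulr0 ltr10.
have Jlt : Jsys c T f' < Jsys c T fh.
  by move: hPoA; rewrite Jf' ltr_pdivlMr // mul1r.
have [f [ff Jf]] := NE_common_improvement _ _ _ _ _ _ hT _ _ hr hNE ff' Jlt.
(* A single profile with weight 1 is a point of the bargaining set. *)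
have fG : inG (L := L) c r T (Jcost c T f).
  exists 1, (fun=> 1), (fun=> f); do !split => //; first by rewrite big_ord1.
  by move=> i; rewrite big_ord1 mul1r.
split; first by exists (Jcost c T f).
move=> gt hgt; have gtlt := NBS_lt _ _ _ _ _ _ fG Jf hgt.
split=> //; rewrite ltr_pM2r ?invr_gt0 //.
(* Summing strict inequalities strictly takes at least one user; positive equilibrium cost supplies
   one. *)
have [i _] : exists i, 0 < Jcost c T fh i.
  apply: exists_gt0_of_sum_gt0; apply: le_lt_trans Jlt.
  exact: (Jsys_ge0 _ _ _ _ _ _ hT _ ff').
by apply: ltr_sum => //; apply/hasP; exists i; rewrite ?mem_index_enum.
Qed.
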